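(* Let $a,b,c$ be real numbers with $c\le a<0$ and $b\in\mathbb{R}$, let $k\ge 1$ be an integer, and let $R(z)=\sum_{i=1}^k a_{2i}z^{2i}$ with $a_{2i}>0$ for $i=1,\dots,k$. Then $$F(x,y,z)=(y,-x,0)+\big((ax+by)R(z),\,(-bx+cy)R(z),\,-zR(z)\big)$$ is an almost Hurwitz vector field on $\mathbb{R}^3$. Moreover, for every $\alpha>\max\left\{2,\frac{a+c-1-2k}{2a},\frac{3-a-c}{2}\right\}$, the function $\rho(x,y,z)=(x^2+y^2+R(z))^{-\alpha}$ is a density function for the system $(\dot x,\dot y,\dot z)=F(x,y,z)$.
   Context: A $C^1$ vector field $F$ on $\mathbb{R}^n$ is almost Hurwitz if there is a set $N\subset\mathbb{R}^n$ of zero Lebesgue measure such that for all $p\in\mathbb{R}^n\setminus N$ all eigenvalues of the Jacobian matrix $JF(p)$ have negative real part. A density function of a system $\dot x=F(x)$, where $F:\mathbb{R}^n\to\mathbb{R}^n$ is $C^1$ and $F(0)=0$, is a $C^1$ map $\rho:\mathbb{R}^n\setminus\{0\}\to[0,+\infty)$, integrable outside a ball centered at the origin, such that $[\nabla\cdot(\rho F)](x)>0$ for almost every $x\in\mathbb{R}^n$ (Lebesgue measure), where $\nabla\cdot(\rho F)=\nabla\rho\cdot F+\rho\,(\nabla\cdot F)$. *)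

(* Defs.v *)
From HB Require Import structures.
From mathcomp Require Import all_boot all_order all_algebra.
From mathcomp Require Import complex.
From mathcomp Require Import all_classical all_reals all_analysis.

Set Implicit Arguments.
Unset Strict Implicit.
Unset Printing Implicit Defensive.

Import Order.TTheory GRing.Theory Num.Theory.
Import numFieldNormedType.Exports.

Local Open Scope classical_set_scope.
Local Open Scope ring_scope.

(* The library has no Lebesgue measure on R^n for general n. Row vectors get
   the sigma-algebra generated by the coordinate maps, i.e. the Borel sets. *)

Fact measure_rV_display : measure_display.
Proof. exact: default_measure_display. Qed.

Section measurable_rV.
Variables (R : realType) (n : nat).

Let coors : 'I_n -> 'rV[R]_n -> measurableTypeR R := fun i v => v ord0 i.

Let rV_set0 : g_sigma_preimage coors set0.
Proof. exact: sigma_algebra0. Qed.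

Let rV_setC A : g_sigma_preimage coors A -> g_sigma_preimage coors (~` A).
Proof. exact: sigma_algebraC. Qed.

Let rV_bigcup (F : _^nat) : (forall i, g_sigma_preimage coors (F i)) ->
  g_sigma_preimage coors (\bigcup_i (F i)).
Proof. exact: sigma_algebra_bigcup. Qed.

HB.instance Definition _ := @isMeasurable.Build measure_rV_display
  'rV[R]_n (g_sigma_preimage coors) rV_set0 rV_setC rV_bigcup.

End measurable_rV.

Section lebesgue_rV.
Variable R : realType.
Notation mR := (measurableTypeR R).

Lemma measurable_coord n (i : 'I_n) :
  measurable_fun setT (fun v : 'rV[R]_n => v ord0 i : mR).
Proof.
move=> _ Y mY; rewrite setTI; apply: sub_sigma_algebra => /=.
rewrite -bigcup_seq/=; exists i => /=; first by rewrite mem_index_enum.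
by exists Y => //; rewrite setTI.
Qed.

Lemma measurable_fun_rV d (T : measurableType d) n (f : T -> 'rV[R]_n) :
  (forall i, measurable_fun setT (fun t => f t ord0 i : mR)) ->
  measurable_fun setT f.
Proof.
move=> mf _ Y; rewrite setTI => mY.
suff : g_sigma_preimage (fun i (v : 'rV[R]_n) => v ord0 i : mR)
    `<=` (fun A => measurable (f @^-1` A)) by exact.
apply: smallest_sub.
  split=> /= [|A mA|F mF].
  - by rewrite preimage_set0.
  - by rewrite setTD preimage_setC; exact: measurableC.
  - by rewrite preimage_bigcup; exact: bigcupT_measurable.
rewrite -bigcup_seq => A [i _ [B mB <-]] /=.
by rewrite setTI -comp_preimage -[X in measurable X]setTI; exact: mf.
Qed.

Definition rV_cons n (t : mR * 'rV[R]_n) : 'rV[R]_n.+1 :=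
  \row_j if unlift ord0 j is Some i then t.2 ord0 i else t.1.

Definition rV_uncons n (v : 'rV[R]_n.+1) : mR * 'rV[R]_n :=
  (v ord0 ord0, \row_(j < n) v ord0 (lift ord0 j)).

Lemma rV_uncons_cons n : cancel (@rV_cons n) (@rV_uncons n).
Proof.
move=> [x v]; rewrite /rV_cons /rV_uncons/=; congr pair.
  by rewrite mxE unlift_none.
by apply/rowP => j; rewrite !mxE liftK.
Qed.

Lemma measurable_rV_cons n : measurable_fun setT (@rV_cons n).
Proof.
apply: measurable_fun_rV => i.
have [->|[j ->]] : i = ord0 \/ exists j, i = lift ord0 j.
  by case: (unliftP ord0 i) => [j ->|->]; [right; exists j|left].
- rewrite (_ : (fun _ => _) = fst); first exact: measurable_fst.
  by apply/funext => t; rewrite mxE unlift_none.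
- rewrite (_ : (fun _ => _) = (fun v : 'rV[R]_n => v ord0 j : mR) \o snd).
    by apply: measurableT_comp => //; exact: measurable_coord.
  by apply/funext => t; rewrite mxE liftK.
Qed.

Lemma measurable_rV_uncons n : measurable_fun setT (@rV_uncons n).
Proof.
apply/measurable_fun_pairP; split; first exact: measurable_coord.
apply: measurable_fun_rV => j.
rewrite (_ : (fun _ => _) = fun v : 'rV[R]_n.+1 => v ord0 (lift ord0 j)).
  exact: measurable_coord.
by apply/funext => v /=; rewrite mxE.
Qed.

HB.instance Definition _ n := @isMeasurableFun.Build _ _ _ _
  (@rV_cons n) (@measurable_rV_cons n).

Section step.
Variables (n : nat) (m : {sigma_finite_measure set 'rV[R]_n -> \bar R}).

Definition lebesgue_rVS : set 'rV[R]_n.+1 -> \bar R :=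
  pushforward (@lebesgue_measure R \x m)%E (@rV_cons n).

Let lebesgue_rVS0 : lebesgue_rVS set0 = 0%E.
Proof. exact: measure0. Qed.

Let lebesgue_rVS_ge0 A : (0 <= lebesgue_rVS A)%E.
Proof. exact: measure_ge0. Qed.

Let lebesgue_rVS_sigma_additive : semi_sigma_additive lebesgue_rVS.
Proof. exact: (@measure_semi_sigma_additive _ _ _ (pushforward _ _)). Qed.

HB.instance Definition _ := isMeasure.Build _ _ _ lebesgue_rVS
  lebesgue_rVS0 lebesgue_rVS_ge0 lebesgue_rVS_sigma_additive.

Let lebesgue_rVS_sigma_finite : sigma_finite setT lebesgue_rVS.
Proof.
have /sigma_finiteP[F [TF ndF Foo]] := sigma_finiteT (@lebesgue_measure R).
have /sigma_finiteP[G [TG ndG Goo]] := sigma_finiteT m.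
exists (fun k => @rV_uncons n @^-1` (F k `*` G k)).
  rewrite -preimage_bigcup; apply/esym/seteqP; split => // v _.
  have [i _ Fi] : (\bigcup_i F i) (rV_uncons v).1 by rewrite -TF.
  have [j _ Gj] : (\bigcup_i G i) (rV_uncons v).2 by rewrite -TG.
  exists (maxn i j) => //; split.
  - by move: Fi; exact/subsetPset/ndF/leq_maxl.
  - by move: Gj; exact/subsetPset/ndG/leq_maxr.
move=> k; have [mF Fk] := Foo k; have [mG Gk] := Goo k.
have mFG : measurable (F k `*` G k) by exact: measurableX.
split; first by rewrite -[X in measurable X]setTI; exact: measurable_rV_uncons.
rewrite /lebesgue_rVS /pushforward -comp_preimage.
rewrite (_ : _ \o _ = id) ?preimage_id; last first.
  by apply/funext => t /=; rewrite rV_uncons_cons.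
by rewrite product_measure1E// lte_mul_pinfty// ge0_fin_numE.
Qed.

HB.instance Definition _ := @Measure_isSigmaFinite.Build _ _ _ lebesgue_rVS
  lebesgue_rVS_sigma_finite.

End step.

(* The n-fold product of the Lebesgue measure of R, carried by row vectors;
   on the one-point space 'rV_0 it is the unit mass. *)
Fixpoint lebesgue_rV n : {sigma_finite_measure set 'rV[R]_n -> \bar R} :=
  match n with
  | 0 => \d_(0 : 'rV[R]_0)
  | n'.+1 => lebesgue_rVS (lebesgue_rV n')
  end.

End lebesgue_rV.

Section vector_fields.
Variables (R : realType) (n : nat).
Implicit Types (F : 'rV[R]_n -> 'rV[R]_n) (rho : 'rV[R]_n -> R).

(* Meant for open U; 'D_('e_i) is the i-th partial derivative. *)
Definition C1_on (V : normedModType R) (U : set 'rV[R]_n)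
    (f : 'rV[R]_n -> V) : Prop :=
  forall p, U p -> differentiable f p /\
    forall i : 'I_n, {for p, continuous ('D_(delta_mx 0 i) f)}.

(* With the library's convention v *m jacobian F p = DF(p) v, so row
   eigenvectors of this matrix are the usual eigenvectors of JF(p). *)
Definition Hurwitz_at F (p : 'rV[R]_n) : Prop :=
  forall l : R[i],
    eigenvalue (map_mx (real_complex R) (jacobian F p)) l -> complex.Re l < 0.

Definition almost_Hurwitz F : Prop :=
  C1_on setT F /\
  exists N : set 'rV[R]_n, (lebesgue_rV R n).-negligible N /\
    forall p, ~ N p -> Hurwitz_at F p.

Definition divergence F (p : 'rV[R]_n) : R :=
  \sum_(i < n) 'D_(delta_mx 0 i) (fun q => F q 0 i) p.

(* The norm of the library on row vectors is the sup norm. *)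
Definition l2norm (p : 'rV[R]_n) : R := Num.sqrt (\sum_(i < n) p 0 i ^+ 2).

(* rho is total here; its value at the origin is irrelevant. As rho is C^1, hence
   bounded on compact annuli, the choice of the radius r is immaterial. *)
Definition density_function F rho : Prop :=
  [/\ C1_on setT F /\ F 0 = 0,
      C1_on [set p | p != 0] rho,
      forall p, p != 0 -> 0 <= rho p,
      exists2 r : R, 0 < r &
        (lebesgue_rV R n).-integrable [set p | r < l2norm p] (EFin \o rho) &
      {ae lebesgue_rV R n, forall p, p != 0 ->
        0 < divergence (fun q => rho q *: F q) p}].

End vector_fields.

Definition vec3 (R : realType) (x y z : R) : 'rV[R]_3 :=
  \row_(i < 3) [:: x; y; z]`_i.

(* Main.v *)
Require Import Defs.
From HB Require Import structures.
From mathcomp Require Import all_boot all_order all_algebra.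
From mathcomp Require Import complex.
From mathcomp Require Import all_classical all_reals all_analysis.
From mathcomp Require Import measurable_realfun.
From mathcomp Require Import ring lra.
Set Implicit Arguments.
Unset Strict Implicit.
Unset Printing Implicit Defensive.
Import Order.TTheory GRing.Theory Num.Theory.
Import numFieldNormedType.Exports.
Local Open Scope classical_set_scope.
Local Open Scope ring_scope.

(** The field F rotates in the (x, y) plane, plus P(z) times a field that contracts
in every direction, where P is the even polynomial in z.

Spectrum.  The Jacobian at a point with P = P(z) and P' = P'(z) is block
triangular.  One block is the eigenvalue -(P + z P'), negative when z <> 0.  The
other is the 2 x 2 matrix with diagonal (a P, c P) and off-diagonal entries
+-(1 + b P): its symmetric part is negative definite when z <> 0, so its
eigenvalues have negative real part ([Re_eigenvalue_skew]).  The exceptional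
points lie on the plane z = 0, which is null ([lebesgue_rV_hyperplane]).

Divergence.  Put S = x^2 + y^2 + P(z).  With rho = S^(-alpha),
  div (rho F) = S^(-alpha - 1) (S div F - alpha grad S . F),
  div F = (a + c - 1) P - z P',
  grad S . F = 2 P (a x^2 + c y^2) - z P' P.
The bracket is x^2 A + y^2 B + P C, and the bounds 2 P <= z P' <= 2 k P
([even_polynomial_euler_bounds]) turn the three lower bounds on alpha and c <= a
into A, B, C > 0 as soon as z <> 0 ([divergence_factor_gt0]).

Integrability.  Outside the unit ball S >= m (1 + |p|)^2 for some m > 0, since the
quadratic term of P controls z^2.  Hence rho <= C (1 + |p|)^(-2 alpha) with
2 alpha > 3.  As |v_i| <= |p| for each coordinate, (1 + |p|)^(-s) is at most the
product of the (1 + |v_i|)^(-s/n), and for s > n each factor is integrable on the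
line; the integral of a product of functions of one coordinate is computed by
iterating Tonelli's theorem ([integral_prod_coord], [integrable_l2norm_decay]). *)

(** * Calculus of C^1 maps *)

Lemma is_derive_comp_real (R : realType) (V : normedModType R) (h : R -> R)
    (f : V -> R) (p v : V) (dh df : R) :
  differentiable f p -> is_derive (f p) 1 h dh -> is_derive p v f df ->
  is_derive p v (h \o f) (df * dh).
Proof.
move=> Df [Dh <-] [_ <-].
have Dh' : differentiable h (f p) by exact/derivable1_diffP.
apply: DeriveDef; first exact/diff_derivable/differentiable_comp.
have Dhf : differentiable (h \o f) p by exact: differentiable_comp.
have -> : 'D_v (h \o f) p = 'd h (f p) ('d f p v).
  by rewrite (deriveE _ Dhf) (diff_comp Df Dh').
rewrite (deriveE _ Df) (deriveE _ Dh') -[X in 'd h _ X]mulr1.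
exact: linearZ.
Qed.

Section C1_calculus.
Variables (R : realType) (n : nat) (U : set 'rV[R]_n).
Hypothesis oU : open U.

(** Continuity of a partial derivative at a point of U is a statement about its
germ, so on an open set it may be checked on any closed formula for it. *)
Lemma C1_onP (V : normedModType R) (f : 'rV[R]_n -> V)
    (df : 'I_n -> 'rV[R]_n -> V) :
  (forall p, U p -> differentiable f p) ->
  (forall i p, U p -> 'D_(delta_mx 0 i) f p = df i p) ->
  (forall i p, U p -> {for p, continuous (df i)}) -> C1_on U f.
Proof.
move=> Df Ef cdf p Up; split; first exact: Df.
move=> i; rewrite /prop_for /continuous_at Ef//.
have Up' : nbhs p U by exact: open_nbhs_nbhs.
have E : {near p, df i =1 'D_(delta_mx 0 i) f}.
  by near=> q; rewrite -Ef//; near: q; exact: Up'.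
exact: cvg_trans (near_eq_cvg E) (cdf i p Up).
Unshelve. all: by end_near.
Qed.

Lemma C1_on_continuous (V : normedModType R) (f : 'rV[R]_n -> V) p :
  C1_on U f -> U p -> {for p, continuous f}.
Proof. by move=> Cf /Cf[/differentiable_continuous]. Qed.

Lemma C1_on_cst (V : normedModType R) (x : V) : C1_on U (cst x).
Proof.
apply: (@C1_onP _ _ (fun _ => cst 0)) => [p _|i p _|i p _].
- exact: differentiable_cst.
- exact: derive_cst.
- exact: (@cst_continuous _ _ _ p).
Qed.

Lemma C1_onD (V : normedModType R) (f g : 'rV[R]_n -> V) :
  C1_on U f -> C1_on U g -> C1_on U (f \+ g).
Proof.
move=> Cf Cg.
apply: (@C1_onP _ _
  (fun i q => 'D_(delta_mx 0 i) f q + 'D_(delta_mx 0 i) g q)) => [p Up|i p Up|i p Up].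
- by apply: differentiableD; [case: (Cf _ Up)|case: (Cg _ Up)].
- by rewrite deriveD//; apply: diff_derivable; [case: (Cf _ Up)|case: (Cg _ Up)].
- by apply: continuousD; [case: (Cf _ Up)|case: (Cg _ Up)].
Qed.

Lemma C1_onM (f g : 'rV[R]_n -> R) :
  C1_on U f -> C1_on U g -> C1_on U (f \* g).
Proof.
move=> Cf Cg.
apply: (@C1_onP _ _ (fun i q => f q * 'D_(delta_mx 0 i) g q
  + g q * 'D_(delta_mx 0 i) f q)) => [p Up|i p Up|i p Up].
- by apply: differentiableM; [case: (Cf _ Up)|case: (Cg _ Up)].
- by rewrite deriveM//; apply: diff_derivable; [case: (Cf _ Up)|case: (Cg _ Up)].
- have [cf cg] := (C1_on_continuous Cf Up, C1_on_continuous Cg Up).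
  by apply: continuousD; apply: continuousM => //;
    [case: (Cg _ Up)|case: (Cf _ Up)].
Qed.

Lemma C1_onZl (V : normedModType R) (f : 'rV[R]_n -> R) (x : V) :
  C1_on U f -> C1_on U (fun q => f q *: x).
Proof.
move=> Cf.
apply: (@C1_onP _ _ (fun i q => 'D_(delta_mx 0 i) f q *: x)) => [p Up|i p Up|i p Up].
- by apply: differentiableZl; case: (Cf _ Up).
- have [Df _] := Cf _ Up.
  by rewrite !deriveE ?diffZl//; exact: differentiableZl.
- have [_ cf] := Cf _ Up.
  exact/continuousZr_tmp/cf.
Qed.

Lemma C1_on_sum (V : normedModType R) I (s : seq I) (f : I -> 'rV[R]_n -> V) :
  (forall i, C1_on U (f i)) -> C1_on U (fun q => \sum_(i <- s) f i q).
Proof.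
move=> Cf; elim: s => [|i s ih].
  under eq_fun do rewrite big_nil; exact: C1_on_cst.
by under eq_fun do rewrite big_cons; exact: C1_onD.
Qed.

(** Decomposing along the canonical basis reduces vector-valued maps to the scalar
calculus above. *)
Lemma C1_on_rV m (f : 'rV[R]_n -> 'rV[R]_m) :
  (forall j, C1_on U (fun q => f q 0 j)) -> C1_on U f.
Proof.
move=> Cf; rewrite (_ : f = fun q => \sum_j f q 0 j *: delta_mx 0 j).
  by apply: C1_on_sum => j; exact: C1_onZl.
by apply/funext => q; exact: row_sum_delta.
Qed.

Lemma is_derive_coord (p v : 'rV[R]_n) i :
  is_derive p v (fun q : 'rV[R]_n => q 0 i : R) (v 0 i).
Proof.
have Dc := @differentiable_coord R 1 n p 0 i.
apply: DeriveDef; first exact: diff_derivable.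
have := @derive_mx R _ 1 n id p v (@derivable_id _ _ _ _).
by rewrite derive_id => /matrixP/(_ 0 i); rewrite mxE => ->.
Qed.

Lemma C1_on_coord i : C1_on U (fun q : 'rV[R]_n => q 0 i : R).
Proof.
apply: (@C1_onP _ _ (fun j _ => (delta_mx 0 j : 'rV[R]_n) 0 i)) => [p Up|j p Up|j p Up].
- exact: differentiable_coord.
- by rewrite (derive_val (is_derive := is_derive_coord _ _ _)).
- exact: (@cst_continuous _ _ _ p).
Qed.

Lemma C1_on_comp (h dh : R -> R) (f : 'rV[R]_n -> R) :
  (forall p, U p -> is_derive (f p) 1 h (dh (f p))) ->
  (forall p, U p -> {for f p, continuous dh}) ->
  C1_on U f -> C1_on U (h \o f).
Proof.
move=> Dh cdh Cf.
apply: (@C1_onP _ _ (fun i q => 'D_(delta_mx 0 i) f q * dh (f q))) =>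
    [p Up|i p Up|i p Up].
- apply: differentiable_comp; first by case: (Cf _ Up).
  by apply/derivable1_diffP; case: (Dh _ Up).
- have [Df _] := Cf _ Up.
  apply: derive_val; apply: is_derive_comp_real => //; first exact: Dh.
  exact/derivableP/diff_derivable.
- have [_ cf] := Cf _ Up.
  apply: continuousM; first exact: cf.
  apply: continuous_comp; first exact: C1_on_continuous.
  exact: cdh.
Qed.

Lemma C1_on_horner (q : {poly R}) (f : 'rV[R]_n -> R) :
  C1_on U f -> C1_on U (fun p => q.[f p]).
Proof.
apply: (@C1_on_comp (horner q) (horner q^`())) => p Up.
exact: continuous_horner.
Qed.

End C1_calculus.

Lemma jacobianE (R : realType) m n (f : 'rV[R]_m -> 'rV[R]_n) p i j :
  differentiable f p ->
  jacobian f p i j = 'D_(delta_mx 0 i) (fun q => f q 0 j) p.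
Proof.
move=> Df; have := deriveEjacobian (delta_mx 0 i) Df.
rewrite derive_mx; last exact: diff_derivable.
by rewrite -rowE => /matrixP/(_ 0 j); rewrite !mxE.
Qed.

(** * The vector field and its Jacobian *)

Lemma sum_ord3 (V : nmodType) (f : 'I_3 -> V) : \sum_(i < 3) f i = f 0 + f 1 + f 2.
Proof.
rewrite !big_ord_recl big_ord0 addr0 addrA; do ?congr (_ + _); congr f; exact: val_inj.
Qed.

Lemma forall_ord3 (A : 'I_3 -> Prop) : A 0 -> A 1 -> A 2 -> forall i, A i.
Proof.
by move=> A0 A1 A2 [[|[|[|//]]] i]; [move: A0|move: A1|move: A2];
  congr A; exact: val_inj.
Qed.

Section field.
Variables (R : realType) (a b c : R) (P : R -> R).

Definition spiral (p : 'rV[R]_3) : 'rV[R]_3 :=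
    let x := p 0 0 in let y := p 0 1 in let z := p 0 2 in
    vec3 y (- x) 0 +
    vec3 ((a * x + b * y) * P z) ((- b * x + c * y) * P z) (- z * P z).

Lemma spiral0E p : spiral p 0 0 = p 0 1 + (a * p 0 0 + b * p 0 1) * P (p 0 2).
Proof. by rewrite !mxE. Qed.
Lemma spiral1E p : spiral p 0 1 = - p 0 0 + (- b * p 0 0 + c * p 0 1) * P (p 0 2).
Proof. by rewrite !mxE. Qed.
Lemma spiral2E p : spiral p 0 2 = - p 0 2 * P (p 0 2).
Proof. by rewrite !mxE/= add0r. Qed.

End field.


(** Derivation rules for functions given pointwise and with values in R itself, so
that the derivatives they produce are expressions that [ring] understands. *)
Section is_derive_pointwise.
Variables (R : realType) (V : normedModType R) (f g : V -> R).
Variables (p v : V) (df dg : R).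

Lemma is_derive_add : is_derive p v f df -> is_derive p v g dg ->
  is_derive p v (fun q => f q + g q) (df + dg).
Proof. exact: is_deriveD. Qed.

Lemma is_derive_mul : is_derive p v f df -> is_derive p v g dg ->
  is_derive p v (fun q => f q * g q) (df * g p + f p * dg).
Proof.
move=> Df Dg; apply: is_derive_eq (is_deriveM Df Dg) _.
by rewrite addrC; congr (_ + _); exact: mulrC.
Qed.

Lemma is_derive_opp : is_derive p v f df -> is_derive p v (fun q => - f q) (- df).
Proof. exact: is_deriveN. Qed.

Lemma is_derive_const k : is_derive p v (fun=> k : R) 0.
Proof. exact: is_derive_cst. Qed.

End is_derive_pointwise.

Section field_derive.
Variables (R : realType) (a b c : R) (P : {poly R}).
Local Notation F := (spiral a b c (horner P)).
Local Notation dP := (P^`()).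
Implicit Types p v : 'rV[R]_3.

Lemma is_derive_horner_coord p v i :
  is_derive p v (fun q : 'rV[R]_3 => P.[q 0 i]) (v 0 i * dP.[p 0 i]).
Proof.
exact: (is_derive_comp_real (@differentiable_coord R _ _ p 0 i)
  (is_derive_poly P _) (is_derive_coord p v i)).
Qed.

Lemma is_derive_linear2 s t p v : is_derive p v
  (fun q : 'rV[R]_3 => s * q 0 0 + t * q 0 1) (s * v 0 0 + t * v 0 1).
Proof.
apply: is_derive_eq (is_derive_add
  (is_derive_mul (is_derive_const p v s) (is_derive_coord p v 0))
  (is_derive_mul (is_derive_const p v t) (is_derive_coord p v 1))) _.
by rewrite !mul0r !add0r.
Qed.

Lemma is_derive_spiral0 p v : is_derive p v (fun q => F q 0 0)
  (v 0 1 + ((a * v 0 0 + b * v 0 1) * P.[p 0 2] +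
            (a * p 0 0 + b * p 0 1) * (v 0 2 * dP.[p 0 2]))).
Proof.
under eq_fun do rewrite spiral0E.
exact: is_derive_add (is_derive_coord p v 1)
  (is_derive_mul (is_derive_linear2 a b p v) (is_derive_horner_coord p v 2)).
Qed.

Lemma is_derive_spiral1 p v : is_derive p v (fun q => F q 0 1)
  (- v 0 0 + ((- b * v 0 0 + c * v 0 1) * P.[p 0 2] +
            (- b * p 0 0 + c * p 0 1) * (v 0 2 * dP.[p 0 2]))).
Proof.
under eq_fun do rewrite spiral1E.
exact: is_derive_add (is_derive_opp (is_derive_coord p v 0))
  (is_derive_mul (is_derive_linear2 (- b) c p v) (is_derive_horner_coord p v 2)).
Qed.

Lemma is_derive_spiral2 p v : is_derive p v (fun q => F q 0 2)
  (- v 0 2 * P.[p 0 2] + - p 0 2 * (v 0 2 * dP.[p 0 2])).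
Proof.
under eq_fun do rewrite spiral2E.
exact: is_derive_mul (is_derive_opp (is_derive_coord p v 2))
  (is_derive_horner_coord p v 2).
Qed.

Lemma C1_on_spiral : C1_on setT F.
Proof.
have oT : open [set: 'rV[R]_3] by exact: openT.
have X i := @C1_on_coord R _ _ oT i.
have K k := @C1_on_cst R _ _ oT R k.
have Q := C1_on_horner oT P (X 2).
have L s t := C1_onD oT (C1_onM oT (K s) (X 0)) (C1_onM oT (K t) (X 1)).
have N i : C1_on setT (fun q : 'rV[R]_3 => - q 0 i).
  rewrite (_ : (fun _ => _) = cst (-1) \* (fun q : 'rV[R]_3 => q 0 i)).
    by have := C1_onM oT (K (-1)) (X i).
  by apply/funext => q /=; rewrite mulN1r.
apply: (C1_on_rV oT); apply: forall_ord3.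
- under eq_fun do rewrite spiral0E.
  by have := C1_onD oT (X 1) (C1_onM oT (L a b) Q).
- under eq_fun do rewrite spiral1E.
  by have := C1_onD oT (N 0) (C1_onM oT (L (- b) c) Q).
- under eq_fun do rewrite spiral2E.
  by have := C1_onM oT (N 2) Q.
Qed.

Lemma jacobian_spiral p :
  jacobian F p = \matrix_(i < 3, j < 3)
   let x := p 0 0 in let y := p 0 1 in let z := p 0 2 in
   (nth [::] [:: [:: a * P.[z]; - (1 + b * P.[z]); 0];
       [:: 1 + b * P.[z]; c * P.[z]; 0];
       [:: (a * x + b * y) * dP.[z]; (- b * x + c * y) * dP.[z];
           - (P.[z] + z * dP.[z]) ]] i)`_j.
Proof.
have DF : differentiable F p by have [] := C1_on_spiral (I : setT p).
apply/matrixP => i j; rewrite jacobianE//.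
move: j; apply: forall_ord3.
- rewrite (derive_val (is_derive := is_derive_spiral0 _ _)).
  by move: i; apply: forall_ord3; rewrite !mxE/=; ring.
- rewrite (derive_val (is_derive := is_derive_spiral1 _ _)).
  by move: i; apply: forall_ord3; rewrite !mxE/=; ring.
- rewrite (derive_val (is_derive := is_derive_spiral2 _ _)).
  by move: i; apply: forall_ord3; rewrite !mxE/=; ring.
Qed.

End field_derive.

(** * Eigenvalues *)

Section Hurwitz.
Variable R : realType.

(** Taking the Hermitian product of the eigenvector equation with (v0, v1), the
skew-symmetric part t contributes an imaginary number, so that
Re l (|v0|^2 + |v1|^2) = s |v0|^2 + u |v1|^2. *)
Lemma Re_eigenvalue_skew (s t u : R) (l v0 v1 : R[i]) :
  s < 0 -> u < 0 -> (v0 != 0) || (v1 != 0) ->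
  v0 * s%:C%C + v1 * t%:C%C = l * v0 ->
  v0 * (- t)%:C%C + v1 * u%:C%C = l * v1 -> complex.Re l < 0.
Proof.
case: l v0 v1 => [l1 l2] [x0 y0] [x1 y1] s0 u0; rewrite !eq_complex/= => v_neq0.
move=> /eqP; rewrite eq_complex/= => /andP[/eqP E1 /eqP E2].
move=> /eqP; rewrite eq_complex/= => /andP[/eqP E3 /eqP E4].
have E : l1 * (x0 ^+ 2 + y0 ^+ 2 + (x1 ^+ 2 + y1 ^+ 2)) =
    s * (x0 ^+ 2 + y0 ^+ 2) + u * (x1 ^+ 2 + y1 ^+ 2).
  (* The real and imaginary parts of both equations are combined with the
     coefficients x0, y0, x1, y1; the terms in l2 and t cancel. *)
  have := congr2 +%R (congr2 +%R (congr1 ( *%R x0) E1) (congr1 ( *%R y0) E2))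
    (congr2 +%R (congr1 ( *%R x1) E3) (congr1 ( *%R y1) E4)).
  by lra.
have n0 : 0 <= x0 ^+ 2 + y0 ^+ 2 by rewrite addr_ge0// sqr_ge0.
have n1 : 0 <= x1 ^+ 2 + y1 ^+ 2 by rewrite addr_ge0// sqr_ge0.
have n : 0 < (x0 ^+ 2 + y0 ^+ 2) + (x1 ^+ 2 + y1 ^+ 2).
  rewrite lt_def addr_ge0// andbT !paddr_eq0 ?sqr_ge0// !sqrf_eq0.
  by rewrite negb_and.
rewrite -(pmulr_llt0 _ n) E; move: n n0 n1.
set N0 := x0 ^+ 2 + _; set N1 := x1 ^+ 2 + _ => n n0 n1.
have [N0_gt0|N0_le0] := ltP 0 N0.
  by rewrite ltr_nwDl ?nmulr_rlt0// nmulr_rle0.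
by rewrite ltr_nwDr ?nmulr_rlt0 ?nmulr_rle0//; lra.
Qed.

(** An eigenvector with nonzero last coordinate has eigenvalue -(P + z P'); the others
are eigenvectors of the 2 x 2 block. *)
Lemma spiral_Hurwitz_at (a b c : R) (P : {poly R}) (p : 'rV[R]_3) :
  c <= a -> a < 0 -> 0 < P.[p 0 2] -> 0 <= p 0 2 * P^`().[p 0 2] ->
  Hurwitz_at (spiral a b c (horner P)) p.
Proof.
move=> ca a0 P0 dP0 l /eigenvalueP[v vJ v0].
have E j : \sum_i v 0 i * (jacobian (spiral a b c (horner P)) p i j)%:C%C = l * v 0 j.
  move/matrixP : vJ => /(_ 0 j); rewrite !mxE => <-.
  by apply: eq_bigr => i _; rewrite [X in _ = _ * X]mxE.
have [v2|v2] := eqVneq (v 0 2) 0; last first.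
  have := E 2; rewrite sum_ord3 jacobian_spiral !mxE/= !mulr0 !add0r mulrC.
  by move=> /(mulIf v2) <-/=; rewrite oppr_lt0 ltr_wpDr.
have := E 0; rewrite sum_ord3 jacobian_spiral !mxE/= v2 mul0r addr0 => E0.
have := E 1; rewrite sum_ord3 jacobian_spiral !mxE/= v2 mul0r addr0 => E1.
apply: Re_eigenvalue_skew E0 E1.
- by rewrite nmulr_rlt0.
- by rewrite nmulr_rlt0// (le_lt_trans ca).
- apply: contra_neqT v0; rewrite negb_or !negbK => /andP[/eqP v00 /eqP v01].
  apply/rowP; apply: forall_ord3; by rewrite mxE.
Qed.

End Hurwitz.

(** * Divergence of the density *)

Section density.
Variables (R : realType) (a b c : R) (P : {poly R}).
Local Notation F := (spiral a b c (horner P)).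
Local Notation dP := (P^`()).
Implicit Types p v : 'rV[R]_3.

(** S does not increase along the trajectories of the field, as grad S . F <= 0 when
a, c <= 0, P >= 0 and z P' >= 0. *)
Definition lyapunov (Q : R -> R) p := p 0 0 ^+ 2 + p 0 1 ^+ 2 + Q (p 0 2).
Local Notation S := (lyapunov (horner P)).

Lemma lyapunovE :
  S = fun q : 'rV[R]_3 => q 0 0 * q 0 0 + q 0 1 * q 0 1 + P.[q 0 2].
Proof. by apply/funext => q; rewrite /lyapunov !expr2. Qed.

Lemma is_derive_lyapunov p v : is_derive p v S
  (2 * p 0 0 * v 0 0 + 2 * p 0 1 * v 0 1 + v 0 2 * dP.[p 0 2]).
Proof.
rewrite lyapunovE.
have Dx := is_derive_coord p v 0; have Dy := is_derive_coord p v 1.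
apply: is_derive_eq (is_derive_add (is_derive_add (is_derive_mul Dx Dx)
  (is_derive_mul Dy Dy)) (is_derive_horner_coord P p v 2)) _.
ring.
Qed.

Lemma C1_on_lyapunov (U : set 'rV[R]_3) : open U -> C1_on U S.
Proof.
move=> oU; have X i := @C1_on_coord R _ _ oU i.
have H := C1_onD oU (C1_onD oU (C1_onM oU (X 0) (X 0)) (C1_onM oU (X 1) (X 1)))
  (C1_on_horner oU P (X 2)).
rewrite lyapunovE.
exact: H.
Qed.

Lemma is_derive_powR_lyapunov s p v : 0 < S p ->
  is_derive p v (fun q => S q `^ s)
    ((2 * p 0 0 * v 0 0 + 2 * p 0 1 * v 0 1 + v 0 2 * dP.[p 0 2]) *
     (s * S p `^ (s - 1))).
Proof.
move=> S0; have [DS _] := C1_on_lyapunov openT (I : setT p).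
exact: (is_derive_comp_real DS (is_derive1_powR s S0) (is_derive_lyapunov p v)).
Qed.

Lemma C1_on_powR_lyapunov s (U : set 'rV[R]_3) : open U ->
  (forall p, U p -> 0 < S p) -> C1_on U (fun q => S q `^ s).
Proof.
move=> oU S0.
have Dh p : U p -> is_derive (S p) 1 (fun t : R => t `^ s) (s * S p `^ (s - 1)).
  by move=> Up; apply: is_derive1_powR; exact: S0.
have H := C1_on_comp oU (dh := fun t : R => s * t `^ (s - 1)) Dh _ (C1_on_lyapunov oU).
apply: H => p Up; apply: continuousM; first exact: cst_continuous.
apply: differentiable_continuous; apply/derivable1_diffP.
by apply: derivable_powR; rewrite in_itv/= andbT S0.
Qed.

(** Leibniz rule div (rho F) = grad rho . F + rho div F for rho = S^s, after factoring
S^(s - 1) out; the rotational part of F is orthogonal to grad S and drops out. *)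
Lemma divergence_density_spiral s p : 0 < S p ->
  divergence (fun q => S q `^ s *: F q) p =
  S p `^ (s - 1) *
  (S p * ((a + c - 1) * P.[p 0 2] - p 0 2 * dP.[p 0 2]) +
   s * (2 * P.[p 0 2] * (a * p 0 0 ^+ 2 + c * p 0 1 ^+ 2) -
        p 0 2 * dP.[p 0 2] * P.[p 0 2])).
Proof.
move=> S0; rewrite /divergence sum_ord3.
have DM i v df : is_derive p v (fun q => F q 0 i) df ->
    'D_v (fun q => (S q `^ s *: F q) 0 i) p =
    ((2 * p 0 0 * v 0 0 + 2 * p 0 1 * v 0 1 + v 0 2 * dP.[p 0 2]) *
     (s * S p `^ (s - 1))) * F p 0 i + S p `^ s * df.
  move=> Df; under eq_fun do rewrite mxE.
  exact: (derive_val (is_derive := is_derive_mul (is_derive_powR_lyapunov s v S0) Df)).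
rewrite (DM _ _ _ (is_derive_spiral0 _ _ _ _ _ _)).
rewrite (DM _ _ _ (is_derive_spiral1 _ _ _ _ _ _)).
rewrite (DM _ _ _ (is_derive_spiral2 _ _ _ _ _ _)).
rewrite spiral0E spiral1E spiral2E.
have -> : S p `^ s = S p * S p `^ (s - 1).
  rewrite -{2}(powRr1 (ltW S0)) -powRD ?(gt_eqF S0) ?implybT//.
  by rewrite addrC subrK.
rewrite !mxE/=.
rewrite /lyapunov; set r := powR _ _.
ring.
Qed.

End density.

(** Here w = P(z), e = z P'(z), X = x^2 and Y = y^2.  The expression is
X A + Y B + w C with A, B, C depending on w and e.  A and B are positive by the bound
e <= 2 k w and the condition on 2 a alpha (with c <= a for B), C by the bound
2 w <= e and the condition on 3 - a - c. *)
Lemma divergence_factor_gt0 (R : realType) (a c k alpha w e X Y : R) :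
  c <= a -> a < 0 -> 1 < alpha ->
  (a + c - 1 - 2 * k) / (2 * a) < alpha -> (3 - a - c) / 2 < alpha ->
  0 < w -> 2 * w <= e <= 2 * k * w -> 0 <= X -> 0 <= Y ->
  0 < (X + Y + w) * ((a + c - 1) * w - e) -
      alpha * (2 * w * (a * X + c * Y) - e * w).
Proof.
move=> ca a0 al1 al2 al3 w0 /andP[e1 e2] X0 Y0.
have K1 : 0 < a + c - 1 - 2 * k - 2 * alpha * a.
  have a20 : 2 * a < 0 by lra.
  by move: al2; rewrite ltr_ndivrMr//; lra.
have K2 : 0 < a + c - 3 + 2 * alpha by lra.
have CX : 0 < (a + c - 1) * w - e - 2 * alpha * a * w.
  by apply: lt_le_trans (mulr_gt0 K1 w0) _; lra.
have CY : 0 < (a + c - 1) * w - e - 2 * alpha * c * w.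
  apply: lt_le_trans CX _; have : 0 <= (alpha * w) * (a - c).
    by rewrite !mulr_ge0 ?subr_ge0// ltW// (lt_trans ltr01).
  lra.
have CW : 0 < (a + c - 1) * w + (alpha - 1) * e.
  apply: lt_le_trans (mulr_gt0 K2 w0) _.
  have : 0 <= (alpha - 1) * (e - 2 * w) by rewrite mulr_ge0 ?subr_ge0// ltW.
  lra.
rewrite [ltRHS](_ : _ = X * ((a + c - 1) * w - e - 2 * alpha * a * w) +
  Y * ((a + c - 1) * w - e - 2 * alpha * c * w) +
  w * ((a + c - 1) * w + (alpha - 1) * e)); last by ring.
by rewrite ltr_wpDl ?mulr_gt0// addr_ge0// mulr_ge0// ltW.
Qed.

(** * Product integrals and null hyperplanes *)

Section lebesgue_rV_theory.
Variable R : realType.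
Notation mR := (measurableTypeR R).
Notation mu := (@lebesgue_measure R).

(** By induction on the dimension: either the constrained coordinate is the one just
added, and the hyperplane is a product with a null singleton, or it is a product
with a null hyperplane of smaller dimension. *)
Lemma lebesgue_rV_hyperplane n (i : 'I_n) (t : R) :
  lebesgue_rV R n [set v | v 0 i = t] = 0%E.
Proof.
have mH m (j : 'I_m) : measurable [set v : 'rV[R]_m | v 0 j = t].
  rewrite (_ : [set _ | _] = setT `&` (fun v : 'rV[R]_m => v 0 j : mR) @^-1` [set t]).
    by apply: measurable_coord => //; exact: measurable_set1.
  by rewrite setTI.
elim: n i => [[]//|n ih] i.
have -> : lebesgue_rV R n.+1 [set v | v 0 i = t] =
  (mu \x lebesgue_rV R n)%E (@rV_cons R n @^-1` [set v | v 0 i = t]) by [].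
case: (unliftP ord0 i) => [j ->|->].
  have -> : @rV_cons R n @^-1` [set v | v 0 (lift ord0 j) = t] =
      setT `*` [set v : 'rV[R]_n | v 0 j = t].
    by apply/seteqP; split => -[x v] /=; rewrite mxE liftK => // -[].
  by rewrite product_measure1E//; [rewrite [X in (_ * X)%E](ih j) mule0|exact: mH].
have -> : @rV_cons R n @^-1` [set v | v 0 ord0 = t] = [set t] `*` setT.
  by apply/seteqP; split => -[x v] /=; rewrite mxE unlift_none => // -[].
rewrite product_measure1E//.
by rewrite [X in (X * _)%E](lebesgue_measure_set1 t) mul0e.
Qed.

Lemma measurable_prod_coord n (f : R -> R) :
  measurable_fun setT f ->
  measurable_fun setT (fun v : 'rV[R]_n => \prod_(i < n) f (v 0 i)).
Proof.
move=> mf;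
apply: (@measurable_prod _ _ _ _ _ _ (fun i (v : 'rV[R]_n) => f (v 0 i))) => i _.
by apply: measurableT_comp => //; exact: measurable_coord.
Qed.

(** Tonelli's theorem, once per coordinate; finiteness of M keeps the statement
free of products of infinite quantities. *)
Lemma integral_prod_coord n (f : R -> R) (M : R) :
  measurable_fun setT f -> (forall x, 0 <= f x) ->
  (\int[mu]_x (f x)%:E = M%:E)%E ->
  (\int[lebesgue_rV R n]_v (\prod_(i < n) f (v 0 i))%:E = (M ^+ n)%:E)%E.
Proof.
move=> mf f0 fM.
have P0 m (v : 'rV[R]_m) : 0 <= \prod_(i < m) f (v 0 i) by exact: prodr_ge0.
have mP m : measurable_fun setT (EFin \o (fun v : 'rV[R]_m => \prod_(i < m) f (v 0 i))).
  by apply/measurable_EFinP; exact: measurable_prod_coord.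
elim: n => [|n ih].
  rewrite /= (integral_dirac _ measurableT (mP 0)) /= big_ord0 expr0 mule1.
  by rewrite [LHS]diracE in_setT.
have -> : (\int[lebesgue_rV R n.+1]_v (\prod_(i < n.+1) f (v 0 i))%:E =
    \int[mu \x lebesgue_rV R n]_t (\prod_(i < n.+1) f (rV_cons t 0 i))%:E)%E.
  have /= H := ge0_integral_pushforward (@measurable_rV_cons R n)
    (mu \x lebesgue_rV R n)%E measurableT (mP n.+1).
  rewrite preimage_setT in H; apply: H => v _ /=.
  by rewrite lee_fin P0.
rewrite (eq_integral (fun t : mR * 'rV[R]_n =>
    (f t.1)%:E * (\prod_(i < n) f (t.2 0 i))%:E)%E); last first.
  move=> [x v] _ /=; rewrite big_ord_recl mxE unlift_none -EFinM.
  by congr ((_ * _)%:E); apply: eq_bigr => i _; rewrite mxE liftK.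
rewrite fubini_tonelli1//=; last 2 first.
- apply: emeasurable_funM.
    by apply/measurable_EFinP; apply: measurableT_comp => //; exact: measurable_fst.
  by apply: (measurableT_comp (mP n)); exact: measurable_snd.
- by move=> t; apply: mule_ge0; rewrite lee_fin; [exact: f0|exact: P0].
rewrite /fubini_F/=.
transitivity (\int[mu]_x ((f x)%:E * (M ^+ n)%:E))%E.
  apply: eq_integral => x _; rewrite ge0_integralZl_EFin ?ih//; last exact: mP.
  by move=> v _; rewrite lee_fin P0.
have M0 : 0 <= M.
  by rewrite -lee_fin -fM integral_ge0// => x _; rewrite lee_fin f0.
have mfE : measurable_fun setT (EFin \o (f : mR -> R)) by exact/measurable_EFinP.
rewrite ge0_integralZr//=.
- by rewrite fM -EFinM -exprS.
- by move=> x _; rewrite lee_fin f0.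
- by rewrite lee_fin exprn_ge0.
Qed.

End lebesgue_rV_theory.

(** * Integrability of power decay *)

Section radial.
Variable R : realType.
Notation mR := (measurableTypeR R).
Notation mu := (@lebesgue_measure R).

Lemma cvg_powRN_pinfty (t : R) : 0 < t -> (1 + x) `^ (- t) @[x --> +oo] --> (0 : R).
Proof.
move=> t0; apply/cvgrPdist_le => e e0.
have t_neq0 : t != 0 by rewrite gt_eqF.
near=> x.
have x1 : e `^ (- t^-1) <= 1 + x.
  rewrite -lerBlDl; near: x; exact: nbhs_pinfty_ge.
rewrite sub0r normrN ger0_norm ?powR_ge0// powRN.
have A : (e `^ (- t^-1)) `^ t = e^-1 by rewrite -powRrM mulNr mulVf// powR_inv1 ?ltW.
have x0 : 0 < 1 + x by apply: lt_le_trans x1; exact: powR_gt0.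
rewrite -[leRHS]invrK lef_pV2 ?posrE ?invr_gt0 ?powR_gt0// -A.
by apply: ge0_ler_powR => //; rewrite ?nnegrE ?powR_ge0// ltW.
Unshelve. all: by end_near. Qed.

Lemma is_derive_powR_1D (s x : R) : -1 < x ->
  is_derive x 1 (fun y : R => (1 + y) `^ s) (s * (1 + x) `^ (s - 1)).
Proof.
move=> x1.
have D1 : is_derive x (1 : R) (fun y : R => 1 + y) 1.
  apply: is_derive_eq
    (is_derive_add (is_derive_const _ _ _) (is_derive_id _ _)) _.
  by rewrite add0r.
have x0 : 0 < 1 + x by lra.
have H := is_derive_comp_real _ (is_derive1_powR s x0) D1.
rewrite mul1r in H; apply: H.
by apply/derivable1_diffP; case: D1.
Qed.

(** By symmetry the integral is twice the one over the half line, where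
(1 + x)^(1 - s) / (1 - s) is a primitive that vanishes at infinity. *)
Lemma integral_powR_1D_norm (s : R) : 1 < s ->
  exists M : R, (\int[mu]_x ((1 + `|x|) `^ (- s))%:E = M%:E)%E.
Proof.
move=> s1; pose f (x : R) := (1 + `|x|) `^ (- s).
have s10 : 1 - s != 0 by rewrite subr_eq0 lt_eqF.
have cf : continuous f.
  move=> x; have h0 : 0 < 1 + `|x| by rewrite ltr_pwDl.
  apply: (@continuous_comp _ _ _ (fun x : R => 1 + `|x|) (fun y : R => y `^ (- s))).
    by apply: continuousD; [exact: cst_continuous|exact: norm_continuous].
  apply: differentiable_continuous; apply/derivable1_diffP.
  by apply: derivable_powR; rewrite in_itv/= andbT.
pose G (x : R) := (1 - s)^-1 * (1 + x) `^ (1 - s).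
have DG (x : R) : -1 < x -> is_derive x 1 G ((1 + x) `^ (- s)).
  move=> x1; apply: is_derive_eq
    (is_derive_mul (is_derive_const _ _ _) (is_derive_powR_1D (1 - s) x1)) _.
  by rewrite mul0r add0r mulKf// addrAC subrr add0r.
exists (2 * (0 - G 0)).
rewrite (@ge0_symfun_integralT _ f) //; last 2 first.
- by move=> x; exact: powR_ge0.
- by move=> x; rewrite /f/= normrN.
rewrite -set_itvcy (@ge0_continuous_FTC2y _ f G 0 0)//.
- by move=> x _; exact: powR_ge0.
- exact: continuous_subspaceT.
- rewrite -[X in _ --> X](mulr0 (1 - s)^-1); apply: cvgM; first exact: cvg_cst.
  by rewrite -(opprB s 1); apply: cvg_powRN_pinfty; rewrite subr_gt0.
- by move=> x x0; case: (DG x _) => //; rewrite (lt_trans _ x0)// ltrN10.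
- apply: cvg_at_right_filter; apply: differentiable_continuous.
  by apply/derivable1_diffP; case: (DG 0 _) => //; rewrite ltrN10.
- move=> x; rewrite in_itv/= andbT => x0.
  rewrite derive1E; have [|_ ->] := DG x; first by rewrite (lt_trans _ x0)// ltrN10.
  by rewrite /f gtr0_norm.
Qed.

End radial.

Section decay.
Variable R : realType.

Lemma norm_coord_le_l2norm n (v : 'rV[R]_n) i : `|v 0 i| <= l2norm v.
Proof.
rewrite -sqrtr_sqr ler_wsqrtr// (bigD1 i)//= lerDl.
by apply: sumr_ge0 => j _; exact: sqr_ge0.
Qed.

Lemma ler_powRN (x y s : R) : 0 <= s -> 0 < x -> x <= y -> y `^ (- s) <= x `^ (- s).
Proof.
move=> s0 x0 xy; have y0 := lt_le_trans x0 xy.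
by rewrite !powRN lef_pV2 ?posrE ?powR_gt0// ge0_ler_powR// nnegrE ltW.
Qed.

Lemma measurable_l2norm n : measurable_fun setT (@l2norm R n).
Proof.
apply: (@measurableT_comp _ _ _ _ _ _ (@Num.sqrt R)).
  by apply: continuous_measurable_fun; exact: sqrt_continuous.
apply: (@measurable_sum _ _ _ _ _ _ (fun i (v : 'rV[R]_n) => v 0 i ^+ 2)) => i.
by apply: measurable_funX; exact: measurable_coord.
Qed.

(** Splitting the exponent evenly among the coordinates dominates the radial function
by a product of functions of one variable, which avoids polar coordinates. *)
Lemma integrable_l2norm_decay n (D : set 'rV[R]_n.+1) (f : 'rV[R]_n.+1 -> R) (C s : R) :
  0 <= C -> n.+1%:R < s -> measurable D -> measurable_fun D f ->
  (forall v, D v -> `|f v| <= C * (1 + l2norm v) `^ (- s)) ->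
  (lebesgue_rV R n.+1).-integrable D (EFin \o f).
Proof.
move=> C0 ns mD mf fC; pose t := s / n.+1%:R.
have t1 : 1 < t by rewrite ltr_pdivlMr ?mul1r// ltr0n.
have t0 : 0 <= t by rewrite ltW// (lt_trans ltr01).
pose h (x : R) := (1 + `|x|) `^ (- t).
have mh : measurable_fun setT h.
  apply: (@measurableT_comp _ _ _ _ _ _ (fun y : R => y `^ (- t))) => //.
  by apply: measurable_funD => //.
pose g (v : 'rV[R]_n.+1) := \prod_(i < n.+1) h (v 0 i).
have h0 x : 0 <= h x by exact: powR_ge0.
have g0 v : 0 <= g v by exact: prodr_ge0.
have mg : measurable_fun setT g by exact: measurable_prod_coord.
have ig : (lebesgue_rV R n.+1).-integrable setT (EFin \o g).
  apply/integrableP; split; first exact/measurable_EFinP.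
  have [M hM] := integral_powR_1D_norm t1.
  under eq_integral do rewrite /= ger0_norm//.
  by rewrite (integral_prod_coord n.+1 mh h0 hM) ltry.
have ig' := integrableS measurableT mD (@subsetT _ D)
  (integrableZl measurableT C ig).
apply: (le_integrable mD _ _ ig').
  exact/measurable_EFinP.
move=> v Dv; rewrite -EFinM !abse_EFin lee_fin (le_trans (fC _ Dv))//.
rewrite ger0_norm ?mulr_ge0// ler_wpM2l//.
have -> : - s = - t * n.+1%:R by rewrite mulNr divfK// pnatr_eq0.
rewrite powRrM powR_mulrn ?powR_ge0// -[X in _ ^+ X](card_ord n.+1) -prodr_const.
apply: ler_prod => i _; rewrite powR_ge0/= ler_powRN// ?ltr_pwDl//.
by rewrite lerD2l norm_coord_le_l2norm.
Qed.

End decay.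

(** * The even polynomial and the theorem *)

Section even_polynomial.
Variables (R : realType) (k : nat) (coef : nat -> R).
Hypothesis hk : (1 <= k)%N.
Hypothesis hcoef : forall i, (1 <= i <= k)%N -> 0 < coef (2 * i)%N.

Definition even_polynomial : {poly R} :=
  \sum_(1 <= i < k.+1) coef (2 * i)%N *: 'X^(2 * i).
Local Notation Q := even_polynomial.

Lemma horner_even_polynomial z :
  Q.[z] = \sum_(1 <= i < k.+1) coef (2 * i)%N * z ^+ (2 * i).
Proof. by rewrite horner_sum; apply: eq_bigr => i _; rewrite hornerZ hornerXn. Qed.

(** Euler's operator z d/dz acts diagonally on monomials; comparing its eigenvalues
2 i with 2 and 2 k gives the bounds on z P' below. *)
Lemma horner_euler_even_polynomial z : z * Q^`().[z] =
  \sum_(1 <= i < k.+1) (2 * i)%:R * (coef (2 * i)%N * z ^+ (2 * i)).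
Proof.
rewrite [deriv _]raddf_sum /= horner_sum mulr_sumr; apply: eq_big_nat => i /andP[i1 _].
rewrite derivZ derivXn hornerZ hornerMn hornerXn -mulr_natl.
have -> : z ^+ (2 * i) = z * z ^+ (2 * i).-1.
  by rewrite -exprS prednK// muln_gt0.
ring.
Qed.

Lemma even_monomial_ge0 z i : (1 <= i < k.+1)%N -> 0 <= coef (2 * i)%N * z ^+ (2 * i).
Proof.
move=> ik; rewrite mulr_ge0 ?exprn_even_ge0 ?oddM//.
by rewrite ltW// hcoef// -ltnS.
Qed.

Lemma even_polynomial_ge_sqr z : coef 2 * z ^+ 2 <= Q.[z].
Proof.
rewrite horner_even_polynomial big_ltn ?ltnS// muln1 lerDl big_nat.
by apply: sumr_ge0 => i /andP[i1 ik]; rewrite even_monomial_ge0// ik andbT ltnW.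
Qed.

Lemma even_polynomial_ge0 z : 0 <= Q.[z].
Proof.
apply: le_trans (even_polynomial_ge_sqr z).
by rewrite mulr_ge0 ?sqr_ge0// ltW// (@hcoef 1).
Qed.

Lemma even_polynomial_gt0 z : z != 0 -> 0 < Q.[z].
Proof.
move=> z0; apply: lt_le_trans (even_polynomial_ge_sqr z).
by rewrite mulr_gt0 ?exprn_even_gt0// (@hcoef 1).
Qed.

Lemma even_polynomial_euler_bounds z :
  2 * Q.[z] <= z * Q^`().[z] <= 2 * k%:R * Q.[z].
Proof.
rewrite horner_euler_even_polynomial horner_even_polynomial !mulr_sumr.
apply/andP; split; apply: ler_sum_nat => i ik; apply: ler_wpM2r;
  rewrite ?even_monomial_ge0// -?natrM ler_nat.
- by case/andP: ik => i1 _; rewrite leq_pmulr.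
- by case/andP: ik => _ ik; rewrite leq_mul2l -ltnS ik orbT.
Qed.

Lemma lyapunov_even_gt0 (p : 'rV[R]_3) : p != 0 -> 0 < lyapunov (horner Q) p.
Proof.
move=> p0; have Q0 := even_polynomial_ge0 (p 0 2).
rewrite lt_def /lyapunov !addr_ge0 ?sqr_ge0// andbT.
rewrite !paddr_eq0 ?addr_ge0 ?sqr_ge0// !sqrf_eq0.
apply: contra_neqN p0 => /andP[/andP[/eqP x0 /eqP y0] /eqP z0].
apply/rowP; apply: forall_ord3; rewrite mxE//.
by apply/eqP; apply: contraTT isT => /even_polynomial_gt0; rewrite z0 ltxx.
Qed.

Lemma lyapunov_even_growth (p : 'rV[R]_3) :
  Num.min 1 (coef 2) * l2norm p ^+ 2 <= lyapunov (horner Q) p.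
Proof.
have c0 : 0 < coef 2 by exact: (@hcoef 1).
rewrite sqr_sqrtr; last by apply: sumr_ge0 => i _; exact: sqr_ge0.
rewrite sum_ord3 /lyapunov; apply: le_trans (lerD (lexx _) (even_polynomial_ge_sqr _)).
rewrite mulrDr lerD// ?ler_wpM2r ?sqr_ge0 ?ge_min ?lexx ?orbT//.
by rewrite ler_piMl ?ge_min ?lexx// addr_ge0 ?sqr_ge0.
Qed.

(** Outside the unit ball |p| >= (1 + |p|) / 2, whence the factor 1/4. *)
Lemma density_even_decay (alpha : R) (p : 'rV[R]_3) : 0 <= alpha -> 1 < l2norm p ->
  lyapunov (horner Q) p `^ (- alpha) <=
  (Num.min 1 (coef 2) / 4) `^ (- alpha) * (1 + l2norm p) `^ (- (2 * alpha)).
Proof.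
move=> al0 p1; set m := Num.min 1 (coef 2).
have m0 : 0 < m by rewrite lt_min ltr01; exact: (@hcoef 1).
have n0 : 0 < 1 + l2norm p by lra.
rewrite -mulrN powRrM powR_mulrn ?(ltW n0)// -powRM ?exprn_ge0 ?divr_ge0
  ?(ltW m0) ?(ltW n0)//.
apply: ler_powRN => //; first by rewrite mulr_gt0 ?divr_gt0 ?exprn_gt0.
apply: le_trans (lyapunov_even_growth p).
rewrite -mulrA ler_pM2l//; nra.
Qed.

End even_polynomial.

Lemma measurable_lyapunov (R : realType) (P : {poly R}) :
  measurable_fun setT (lyapunov (horner P)).
Proof.
apply: measurable_funD.
  by apply: measurable_funD; apply: measurable_funX; exact: measurable_coord.
apply: (@measurableT_comp _ _ _ _ _ _ (horner P)); last exact: measurable_coord.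
by apply: continuous_measurable_fun; exact: continuous_horner.
Qed.

Theorem theorem3p4 (R : realType) (a b c : R) (k : nat) (coef : nat -> R)
    (hca : c <= a) (ha : a < 0) (hk : (1 <= k)%N)
    (hcoef : forall i, (1 <= i <= k)%N -> 0 < coef (2 * i)%N) :
  let P (z : R) := \sum_(1 <= i < k.+1) coef (2 * i)%N * z ^+ (2 * i) in
  let F (p : 'rV[R]_3) :=
    let x := p 0 0 in let y := p 0 1 in let z := p 0 2 in
    vec3 y (- x) 0 +
    vec3 ((a * x + b * y) * P z) ((- b * x + c * y) * P z) (- z * P z) in
  almost_Hurwitz F /\
  forall alpha : R,
    Num.max 2 (Num.max ((a + c - 1 - 2 * k%:R) / (2 * a)) ((3 - a - c) / 2))
      < alpha ->
    density_function F (fun p =>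
      let x := p 0 0 in let y := p 0 1 in let z := p 0 2 in
      (x ^+ 2 + y ^+ 2 + P z) `^ (- alpha)).
Proof.
move=> P; pose Q := even_polynomial k coef.
have -> : P = horner Q by apply/funext => z; rewrite horner_even_polynomial.
move=> F; have CF : C1_on setT F := @C1_on_spiral R a b c Q.
have null0 : (lebesgue_rV R 3).-negligible [set p | p 0 2 = 0].
  exists [set p : 'rV[R]_3 | p 0 2 = 0]; split => //.
    rewrite -[X in measurable X]setTI.
    exact: (@measurable_coord R 3 2 measurableT [set 0] (measurable_set1 0)).
  exact: lebesgue_rV_hyperplane.
split.
  split => //; exists [set p | p 0 2 = 0]; split => // p /= /eqP z0.
  apply: spiral_Hurwitz_at => //; first exact: even_polynomial_gt0.
  have /andP[+ _] := even_polynomial_euler_bounds hcoef (p 0 2).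
  by apply: le_trans; rewrite mulr_ge0// even_polynomial_ge0.
move=> alpha; rewrite !gt_max => /and3P[al1 al2 al3].
have al0 : 0 < alpha by lra.
pose S := lyapunov (horner Q).
change (density_function F (fun p => S p `^ (- alpha))).
have oU : open [set p : 'rV[R]_3 | p != 0].
  rewrite (_ : [set p | p != 0] = ~` [set 0]); last first.
    by apply/seteqP; split => p /= /eqP.
  apply: closed_openC; apply: accessible_closed_set1.
  exact/hausdorff_accessible/norm_hausdorff.
split.
- split => //; apply/rowP; apply: forall_ord3.
  + by rewrite spiral0E !mxE !mulr0 addr0 mul0r addr0.
  + by rewrite spiral1E !mxE !mulr0 oppr0 addr0 mul0r addr0.
  + by rewrite spiral2E !mxE oppr0 mul0r.
- by apply: C1_on_powR_lyapunov => // p; exact: lyapunov_even_gt0.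
- by move=> p _; exact: powR_ge0.
- exists 1 => //.
  have mD : measurable [set p : 'rV[R]_3 | 1 < l2norm p].
    rewrite (_ : [set _ | _] = setT `&` (@l2norm R 3) @^-1` `]1, +oo[).
      by apply: measurable_l2norm => //; exact: measurable_itv.
    by apply/seteqP; split => p /=; rewrite in_itv/= andbT; [split|case].
  apply: (@integrable_l2norm_decay R 2 _ _
    ((Num.min 1 (coef 2%N) / 4) `^ (- alpha)) (2 * alpha)) => //.
  + exact: powR_ge0.
  + lra.
  + apply: measurable_funTS.
    apply: (@measurableT_comp _ _ _ _ _ _ (fun y : R => y `^ (- alpha))) => //.
    exact: measurable_lyapunov.
  + move=> p /= p1; rewrite ger0_norm ?powR_ge0//.
    by apply: density_even_decay => //; exact: ltW.
- apply: negligibleS null0 => p /= /not_implyP[p0 /negP Np].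
  apply/eqP; apply: contraNT Np => z0.
  have S0 : 0 < S p by exact: lyapunov_even_gt0.
  rewrite divergence_density_spiral// mulr_gt0 ?powR_gt0//.
  rewrite /S /lyapunov mulNr.
  apply: (@divergence_factor_gt0 R a c k%:R) => //; rewrite ?sqr_ge0//.
  + lra.
  + exact: even_polynomial_gt0.
  + exact: even_polynomial_euler_bounds.
Qed.
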